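(* Let $\mathsf{X}=\{x^1,\dots,x^d\}$ and suppose that $P_0$ is irreducible. Consider the nonlinear state space model whose state $\mu_t$ (a probability measure on $\mathsf{X}$, viewed as a row vector) evolves as $\mu_{t+1}=\mu_t\check P_{\zeta_t}$, with scalar input $\zeta_t$ and output $y_t=\sum_x\mu_t(x)\,\mathcal{U}(x)$. Its unique equilibrium with $\zeta_t\equiv0$ is $\mu_t\equiv\pi_0$ and $y_t\equiv y^0:=\sum_x\pi_0(x)\,\mathcal{U}(x)$. Its linearization around this equilibrium is given by $$\Phi_{t+1}=A\Phi_t+B\zeta_t,\qquad \gamma_t=C\Phi_t,$$ where $A=P_0^{\top}$, $C$ is the row vector of dimension $d$ with $C_i=\mathcal{U}(x^i)$ for each $i$, and $B$ is the $d$-dimensional column vector with entries $B_j=\sum_x\pi_0(x)\,\mathcal{E}(x,x^j)$, where $$\mathcal{E}(x^i,x^j)=\bigl[\widetilde{\mathcal{U}}(x^i)+H(x^j)-H(x^i)\bigr]P_0(x^i,x^j),\qquad x^i,x^j\in\mathsf{X}.$$ The initial condition is $\Phi_0(i)=\mu_0(x^i)-\pi_0(x^i)$, $1\le i\le d$. The matrix $\mathcal{E}$ is equal to the derivative $$\mathcal{E}=\frac{d}{d\zeta}\check P_\zeta\Big|_{\zeta=0}.$$ Consequently, for each pair of states $x^-,x^+\in\mathsf{X}$, as $\zeta\to0$, $$\check P_\zeta(x^-,x^+)=\exp\bigl(\zeta\,\Gamma(x^-,x^+)+O(\zeta^2)\bigr)P_0(x^-,x^+),\qquad \Gamma(x^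-,x^+)=\widetilde{\mathcal{U}}(x^-)+H(x^+)-H(x^-).$$
   Context: $P_0$ is a transition (stochastic) matrix on the finite set $\mathsf{X}$ with unique invariant probability measure $\pi_0$, and $\mathcal{U}\colon\mathsf{X}\to\mathbb{R}$ is a function. For $\zeta\in\mathbb{R}$ let $\widehat P_\zeta(x,y)=e^{\zeta\mathcal{U}(x)}P_0(x,y)$, let $\lambda_\zeta>0$ be its maximal (Perron--Frobenius) eigenvalue, and let $v_\zeta>0$ be a positive eigenvector, $\widehat P_\zeta v_\zeta=\lambda_\zeta v_\zeta$ (unique up to a constant multiple). The controlled transition matrix is $\check P_\zeta(x,y)=\lambda_\zeta^{-1}v_\zeta(x)^{-1}\widehat P_\zeta(x,y)v_\zeta(y)$; $\check P_0=P_0$. Let $\eta_0=\sum_x\pi_0(x)\mathcal{U}(x)$ and $\widetilde{\mathcal{U}}=\mathcal{U}-\eta_0$. Fix a state $\alpha\in\mathsf{X}$, let $\tau=\min\{t\ge1:X_t=\alpha\}$, and define $$H(x)=\mathsf{E}_x\Bigl[\sum_{t=0}^{\tau-1}\widetilde{\mathcal{U}}(X_t)\Bigr],$$ where $\mathsf{E}_x$ is expectation for the chain with transition matrix $P_0$ and $X_0=x$ ($H$ solves Poisson's equation $H-P_0H=\widetilde{\mathcal{U}}$). Linearization around the equilibrium means the first-order Taylor approximation at $(\mu,\zeta)=(\pi_0,0)$ of the state-update and output maps $(\mu,\zeta)\mapsto\mu\check P_\zeta$ and $\mu\mapsto\sum_x\mu(x)\mathcal{U}(x)$, with $\Phi_t$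 (a $d$-dimensional column vector) approximating $\mu_t-\pi_0$ and $\gamma_t$ approximating $y_t-y^0$. *)

(* Defs.v *)
From HB Require Import structures.
From mathcomp Require Import all_boot all_order all_algebra.
From mathcomp Require Import all_classical all_reals all_analysis.
From mathcomp Require Import complex.

Set Implicit Arguments.
Unset Strict Implicit.
Unset Printing Implicit Defensive.

Import Order.TTheory GRing.Theory Num.Theory.
Import numFieldNormedType.Exports.

Local Open Scope classical_set_scope.
Local Open Scope ring_scope.
Local Open Scope complex_scope.

(* The state space is 'I_d; measures on it are row vectors. *)
Section MarkovMatrices.
Context {R : realType} {d : nat}.
Implicit Types (P M : 'M[R]_d) (mu : 'rV[R]_d) (U : 'I_d -> R).

Definition is_pmf mu : Prop :=
  (forall x, 0 <= mu 0 x) /\ \sum_x mu 0 x = 1.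

Definition is_stochastic P : Prop :=
  (forall x y, 0 <= P x y) /\ (forall x, \sum_y P x y = 1).

Definition is_irreducible P : Prop :=
  forall x y, exists n : nat, 0 < (P ^+ n) x y.

Definition is_invariant_pmf P mu : Prop := is_pmf mu /\ mu *m P = mu.

Definition mean U mu : R := \sum_x mu 0 x * U x.

(* [eigenvalue] refers to row eigenvectors; the spectrum is the same as for
   column eigenvectors. Maximality is in modulus, over the complex spectrum. *)
Definition is_perron_eigenvalue M (lam : R) : Prop :=
  [/\ 0 < lam, eigenvalue M lam &
      forall z : R[i],
        eigenvalue (map_mx (real_complex R) M) z -> `|z| <= lam%:C].

Definition tiltedP U P (z : R) : 'M[R]_d :=
  \matrix_(x, y) (expR (z * U x) * P x y).

Definition controlledP U P (lam : R -> R) (v : R -> 'cV[R]_d) (z : R) :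
    'M[R]_d :=
  \matrix_(x, y) ((lam z)^-1 * (v z x 0)^-1 * tiltedP U P z x y * v z y 0).

End MarkovMatrices.

Section MarkovChains.
Context {R : realType} {d : nat} {disp : measure_display}
  {Omega : measurableType disp}.
Implicit Types (P : 'M[R]_d) (X : nat -> Omega -> 'I_d).

Definition path_event X (p : nat -> 'I_d) (n : nat) : set Omega :=
  [set w | forall t, (t <= n)%N -> X t w = p t].

(* Under [Pr], X is the Markov chain with transition matrix P and X_0 = x; the
   last clause is the Markov property with the conditioning multiplied out. *)
Definition is_markov_chain (Pr : probability Omega R) P (x : 'I_d) X : Prop :=
  [/\ forall t y, measurable [set w | X t w = y],
      Pr [set w | X 0 w = x] = 1%E &
      forall p n, Pr (path_event X p n.+1) =
                  (Pr (path_event X p n) * (P (p n) (p n.+1))%:E)%E].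

(* tau = min {t >= 1 : X_t = alpha}, with value 0 on the event that alpha is
   never reached, which is null for an irreducible finite chain. *)
Definition return_time X (alpha : 'I_d) (w : Omega) : nat :=
  if pselect (exists t, (1 <= t)%N && (X t w == alpha)) is left e
  then ex_minn e else 0%N.

Definition excursion_cost (Pr : 'I_d -> probability Omega R) X
    (alpha : 'I_d) (f : 'I_d -> R) (x : 'I_d) : R :=
  fine (expectation (Pr x)
    (fun w => \sum_(0 <= t < return_time X alpha w) f (X t w))).

End MarkovChains.

Section StateSpaceModels.
Context {R : realType} {d : nat}.
Implicit Types (F : 'rV[R]_d * R^o -> 'rV[R]_d) (G : 'rV[R]_d -> R^o).

Definition is_trajectory F G (zeta : nat -> R) (mu : nat -> 'rV[R]_d)
    (y : nat -> R) : Prop :=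
  forall t, [/\ is_pmf (mu t), mu t.+1 = F (mu t, zeta t) & y t = G (mu t)].

(* First-order Taylor approximation of F at (mu_eq, z_eq) and of G at mu_eq,
   run with the input zeta from the initial deviation mu0 - mu_eq. *)
Definition is_linearization F G (mu_eq : 'rV[R]_d) (z_eq : R)
    (zeta : nat -> R) (mu0 : 'rV[R]_d)
    (Phi : nat -> 'cV[R]_d) (gamma : nat -> R) : Prop :=
  [/\ differentiable F (mu_eq, z_eq : R^o), differentiable G mu_eq,
      Phi 0%N = (mu0 - mu_eq)^T,
      forall t, (Phi t.+1)^T =
        'd F (mu_eq, z_eq : R^o) ((Phi t)^T, (zeta t - z_eq : R^o)) &
      forall t, gamma t = 'd G mu_eq (Phi t)^T].

End StateSpaceModels.

Definition state_map {R : realType} {d : nat} (Pz : R -> 'M[R]_d)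
    (s : 'rV[R]_d * R^o) : 'rV[R]_d := s.1 *m Pz s.2.

Section Linearization.
Context {R : realType} {d : nat}.
Variables (P : 'M[R]_d) (U : 'I_d -> R) (pi0 : 'rV[R]_d) (H : 'I_d -> R).

Definition centered (x : 'I_d) : R := U x - mean U pi0.

Definition Gamma (x y : 'I_d) : R := centered x + H y - H x.

Definition calE : 'M[R]_d := \matrix_(x, y) (Gamma x y * P x y).

Definition linA : 'M[R]_d := P^T.

Definition linB : 'cV[R]_d := \col_j \sum_x pi0 0 x * calE x j.

Definition linC : 'rV[R]_d := \row_i U i.

End Linearization.

(* Main.v *)
Require Import Defs.
From HB Require Import structures.
From mathcomp Require Import all_boot all_order all_algebra.
From mathcomp Require Import all_classical all_reals all_analysis.
From mathcomp Require Import measurable_realfun.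
From mathcomp Require Import ring lra.

Set Implicit Arguments.
Unset Strict Implicit.
Unset Printing Implicit Defensive.

Import Order.TTheory GRing.Theory Num.Theory.
Import numFieldNormedType.Exports.

Local Open Scope classical_set_scope.
Local Open Scope ring_scope.

(** H solves Poisson's equation: stopped at the return to alpha, the chain has
    occupation probabilities Pr_x(t < tau, X_t = y) = (T^t)(x, y), where T is P0
    with the column of alpha set to zero, so H = sum_t T^t f with f = U - eta_0.
    By irreducibility 1 - T is invertible, which gives H = f + T H.

    Then e^{z H} is an eigenvector of the tilted matrix for e^{z eta_0}, up to a
    factor e^{O(z^2)} in every row.  Writing v_z = e^{z H} g, the maximum
    principle yields lambda_z = e^{z eta_0 + O(z^2)}, and irreducibility forces g
    to be constant up to O(z^2).  Hence check P_z = e^{z Gamma + O(z^2)} P0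
    entrywise, with no differentiation of lambda_z or v_z, and the derivative and
    the linearization can be read off this expansion. *)

(** * Irreducible chains and the taboo kernel *)

Lemma ex_argmin (R : realType) (I : finType) (i0 : I) (g : I -> R) :
  exists c, forall i, g c <= g i.
Proof.
exists [arg min_(i < i0) g i]%O.
by case: arg_minP => // c _ gc i; exact: gc.
Qed.

Lemma ex_argmax (R : realType) (I : finType) (i0 : I) (g : I -> R) :
  exists c, forall i, g i <= g c.
Proof.
exists [arg max_(i > i0) g i]%O.
by case: arg_maxP => // c _ gc i; exact: gc.
Qed.

Lemma expmx_ge0 (R : realType) (d : nat) (P : 'M[R]_d) (n : nat) x y :
  (forall x y, 0 <= P x y) -> 0 <= (P ^+ n) x y.
Proof.
move=> P0; elim: n x y => [|n IHn] x y.
  by rewrite expr0 mxE mulrn_wge0 ?ler01.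
by rewrite exprSr -mulmxE mxE; apply: sumr_ge0 => z _; apply: mulr_ge0.
Qed.

(** Induction along paths of positive probability: a positive entry of [P ^+ n.+1] has a positive
    summand, which splits into a positive entry of [P ^+ n] and one allowed transition. *)
Lemma irreducible_closed (R : realType) (d : nat) (P : 'M[R]_d)
    (S : 'I_d -> Prop) x :
  (forall x y, 0 <= P x y) -> is_irreducible P ->
  S x -> (forall y z, S y -> 0 < P y z -> S z) -> forall y, S y.
Proof.
move=> P0 irr Sx Scl y; have [n] := irr x y.
elim: n y => [|n IHn] y.
  rewrite expr0 mxE; case: eqP => [<-//|_].
  by rewrite ltxx.
rewrite exprSr -mulmxE mxE => Pxy.
have [z _ xz] : exists2 z, true & 0 < (P ^+ n) x z * P z y.
  apply/exists_inP; apply: contraTT Pxy; rewrite negb_exists_in => /forall_inP H.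
  rewrite -leNgt; apply: sumr_le0 => z _.
  by rewrite leNgt; apply: H.
have Pn0 := @expmx_ge0 _ _ P n x z P0.
have Pz0 := P0 z y.
apply: (Scl z); last first.
  by rewrite lt0r Pz0 andbT; apply: contraTneq xz => ->; rewrite mulr0 ltxx.
apply: IHn.
by rewrite lt0r Pn0 andbT; apply: contraTneq xz => ->; rewrite mul0r ltxx.
Qed.

(** By invariance, the support of [m] is closed under allowed transitions. *)
Lemma nonneg_invariant_gt0 (R : realType) (d : nat) (P : 'M[R]_d)
    (m : 'rV[R]_d) x :
  (forall x y, 0 <= P x y) -> is_irreducible P ->
  (forall y, 0 <= m 0 y) -> m *m P = m -> 0 < m 0 x ->
  forall y, 0 < m 0 y.
Proof.
move=> P0 irr m0 mP mx; apply: (irreducible_closed P0 irr mx) => y z my Pyz.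
rewrite -mP mxE (bigD1 y)//= ltr_pwDl ?mulr_gt0//.
by apply: sumr_ge0 => i _; apply: mulr_ge0.
Qed.

Lemma invariant_pmf_gt0 (R : realType) (d : nat) (P : 'M[R]_d)
    (m : 'rV[R]_d) :
  is_stochastic P -> is_irreducible P -> is_invariant_pmf P m ->
  forall y, 0 < m 0 y.
Proof.
move=> [P0 _] irr [[m0 m1] mP].
have [x mx] : exists x, 0 < m 0 x.
  apply/not_existsP => h.
  suff: \sum_x m 0 x = 0 by rewrite m1 => /eqP; rewrite oner_eq0.
  apply: big1 => x _; apply/eqP; rewrite eq_le m0 andbT leNgt.
  by apply/negP/h.
exact: nonneg_invariant_gt0 mx.
Qed.

(** Subtract from [m] the largest multiple [k *: p] lying below it. The difference is nonnegative,
    invariant and zero at [c]; one positive entry would make all its entries positive, so it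
    vanishes. Equal total masses then give [k = 1]. *)
Lemma invariant_pmf_unique (R : realType) (d : nat) (P : 'M[R]_d)
    (p m : 'rV[R]_d) :
  is_stochastic P -> is_irreducible P -> is_invariant_pmf P p ->
  is_invariant_pmf P m -> m = p.
Proof.
move=> Pst irr pI mI; have p_gt0 := invariant_pmf_gt0 Pst irr pI.
case: pI mI Pst => [[_ p1] pP] [[_ m1] mP] [P0 _].
have [x0|x0] := pickP 'I_d; last first.
  by apply/rowP => i; have := x0 i.
move=> _; have [c cmin] := ex_argmin x0 (fun i => m 0 i / p 0 i).
pose k := m 0 c / p 0 c.
have kle i : k * p 0 i <= m 0 i by rewrite -ler_pdivlMr// cmin.
pose n : 'rV[R]_d := m - k *: p.
have n0 i : 0 <= n 0 i by rewrite !mxE subr_ge0.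
have nP : n *m P = n by rewrite /n mulmxBl -scalemxAl mP pP.
have nc : n 0 c = 0 by rewrite !mxE /k divfK ?subrr// gt_eqF.
have nE i : m 0 i = k * p 0 i.
  apply/eqP; rewrite -subr_eq0; have := n0 i; rewrite le0r !mxE.
  case/orP => // ni.
  have : 0 < n 0 c by apply: (nonneg_invariant_gt0 (x := i)); rewrite ?mxE.
  by rewrite nc ltxx.
have k1 : k = 1.
  by rewrite -m1 (eq_bigr (fun i => k * p 0 i)) -?mulr_sumr ?p1 ?mulr1.
by apply/rowP => i; rewrite nE k1 mul1r.
Qed.

Definition taboo (R : realType) (d : nat) (P : 'M[R]_d) (a : 'I_d) : 'M[R]_d :=
  \matrix_(x, y) (P x y *+ (y != a)).

Lemma taboo_ge0 (R : realType) (d : nat) (P : 'M[R]_d) a x y :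
  (forall x y, 0 <= P x y) -> 0 <= taboo P a x y.
Proof. by move=> P0; rewrite mxE mulrn_wge0. Qed.

(** Maximum principle: from a state where [|h|] is maximal and nonzero, every allowed transition
    avoids [a] and reaches another maximal state. By irreducibility all states are maximal, so none
    leads to [a], against the positive invariant mass of [a]. *)
Lemma taboo_fix0 (R : realType) (d : nat) (P : 'M[R]_d) (p : 'rV[R]_d) a
    (h : 'cV[R]_d) :
  is_stochastic P -> is_irreducible P -> is_invariant_pmf P p ->
  taboo P a *m h = h -> h = 0.
Proof.
move=> Pst irr pI hE; have p_gt0 := invariant_pmf_gt0 Pst irr pI.
case: Pst => P0 P1.
have [c hle] := ex_argmax a (fun i => `|h i 0|).
have [hc|hc] := eqVneq `|h c 0| 0.
  apply/colP => i; rewrite mxE; apply/eqP; rewrite -normr_le0.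
  by rewrite (le_trans (hle i))// hc.
have step x y : `|h x 0| = `|h c 0| -> 0 < P x y ->
    y != a /\ `|h y 0| = `|h c 0|.
  move=> hx Pxy.
  have le1 : `|h c 0| <= \sum_z P x z * (`|h z 0| *+ (z != a)).
    rewrite -hx -{1}hE mxE (le_trans (ler_norm_sum _ _ _))//.
    apply: ler_sum => z _; rewrite mxE normrM.
    by case: eqP => _; rewrite ?mulr1n ?mulr0n ?normr0 ?mul0r ?mulr0// ger0_norm.
  have hlez z : `|h z 0| *+ (z != a) <= `|h c 0|.
    by case: eqP => _; rewrite ?mulr1n ?mulr0n.
  (* The maximum is at most an average of values not exceeding it, so the nonnegative gaps average
     to zero and vanish wherever the weight is positive. *)
  have E : \sum_z P x z * (`|h c 0| - `|h z 0| *+ (z != a)) = 0.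
    apply/eqP; rewrite eq_le; apply/andP; split; last first.
      by apply: sumr_ge0 => z _; rewrite mulr_ge0// subr_ge0.
    under eq_bigr do rewrite mulrBr.
    by rewrite sumrB -mulr_suml P1 mul1r subr_le0.
  have /eqP := E; rewrite psumr_eq0; last first.
    by move=> z _; rewrite mulr_ge0// subr_ge0.
  move=> /allP /(_ y (mem_index_enum _)) /=; rewrite mulf_eq0 gt_eqF//= subr_eq0.
  case: (y =P a) => [_|_]; first by rewrite mulr0n (negbTE hc).
  by rewrite mulr1n => /eqP <-.
have all_c : forall x, `|h x 0| = `|h c 0|.
  apply: (irreducible_closed P0 irr (x := c)) => // x y hx /(step _ _ hx).
  by case.
case: pI => [_ pP]; have := p_gt0 a; rewrite -pP mxE big1 ?ltxx// => x _.
have := P0 x a; rewrite le0r => /orP[/eqP->|Pxa]; first by rewrite mulr0.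
by have [] := step x a (all_c x) Pxa; rewrite eqxx.
Qed.

Lemma taboo_unitmx (R : realType) (d : nat) (P : 'M[R]_d) (p : 'rV[R]_d) a :
  is_stochastic P -> is_irreducible P -> is_invariant_pmf P p ->
  1%:M - taboo P a \in unitmx.
Proof.
(* [kermx] is a left kernel, whereas [taboo_fix0] concerns column vectors; hence the transpose. *)
move=> Pst irr pI; rewrite -unitmx_tr -row_free_unit -kermx_eq0.
apply/eqP/row_matrixP => i; rewrite row0.
set u := row i _.
have uE : u *m (1%:M - taboo P a)^T = 0 by apply/sub_kermxP; exact: row_sub.
apply: trmx_inj; rewrite trmx0; apply: (taboo_fix0 Pst irr pI (a := a)).
apply/eqP; rewrite eq_sym -subr_eq0 -[X in X - _]mul1mx -mulmxBl.
by rewrite -[_ *m _]trmxK trmx_mul trmxK uE trmx0.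
Qed.

Definition taboo_sum (R : realType) (d : nat) (P : 'M[R]_d) a n : 'M[R]_d :=
  \sum_(t < n) taboo P a ^+ t.

Lemma taboo_sumE (R : realType) (d : nat) (P : 'M[R]_d) (p : 'rV[R]_d) a n :
  is_stochastic P -> is_irreducible P -> is_invariant_pmf P p ->
  taboo_sum P a n = invmx (1%:M - taboo P a) *m (1%:M - taboo P a ^+ n).
Proof.
move=> Pst irr pI; have U := taboo_unitmx a Pst irr pI.
have -> : 1%:M - taboo P a ^+ n = (1%:M - taboo P a) *m taboo_sum P a n.
  rewrite /taboo_sum; elim: n => [|n IHn].
    by rewrite expr0 big_ord0 mulmx0 subrr.
  rewrite big_ord_recr/= mulmxDr -IHn mulmxBl mul1mx exprS -mulmxE.
  by rewrite addrA subrK.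
by rewrite mulKmx.
Qed.

(** Survival probability: the chain started at [x] avoids [a] at all times from 1 to [n]. *)
Definition taboo_mass (R : realType) (d : nat) (P : 'M[R]_d) a n x : R :=
  \sum_y (taboo P a ^+ n) x y.

Lemma taboo_mass_le1 (R : realType) (d : nat) (P : 'M[R]_d) a n x :
  is_stochastic P -> taboo_mass P a n x <= 1.
Proof.
move=> [P0 P1]; rewrite /taboo_mass; elim: n x => [|n IHn] x.
  rewrite expr0 (bigD1 x)//= mxE eqxx big1 ?addr0// => y yx.
  by rewrite mxE eq_sym (negbTE yx).
rewrite exprS -mulmxE; under eq_bigr do rewrite mxE.
rewrite exchange_big/= -(P1 x); apply: ler_sum => z _.
rewrite -mulr_sumr; have T0 := taboo_ge0 a x z P0.
rewrite (le_trans (ler_wpM2l T0 (IHn z)))// mulr1 mxE.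
by case: eqP => _; rewrite ?mulr1n ?mulr0n.
Qed.

Lemma taboo_mass_ge0 (R : realType) (d : nat) (P : 'M[R]_d) a n x :
  is_stochastic P -> 0 <= taboo_mass P a n x.
Proof.
move=> [P0 P1]; apply: sumr_ge0 => y _; apply: expmx_ge0 => i j.
exact: taboo_ge0.
Qed.

(** The series adds up the tails of the return time, so this is finiteness of its mean. The
    geometric sum equals [V] applied to [1 - taboo_mass], whose entries lie in [0, 1]; the absolute
    row sum of [V] is therefore a bound. *)
Lemma taboo_mass_series_bounded (R : realType) (d : nat) (P : 'M[R]_d)
    (p : 'rV[R]_d) a x :
  is_stochastic P -> is_irreducible P -> is_invariant_pmf P p ->
  exists B, forall n, \sum_(t < n) taboo_mass P a t x <= B.
Proof.
move=> Pst irr pI; set V := invmx (1%:M - taboo P a).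
exists (\sum_z `|V x z|) => n.
have -> : \sum_(t < n) taboo_mass P a t x =
    \sum_z V x z * (1 - taboo_mass P a n z).
  rewrite /taboo_mass exchange_big/=.
  transitivity (\sum_y taboo_sum P a n x y).
    by apply: eq_bigr => y _; rewrite /taboo_sum summxE.
  rewrite (taboo_sumE _ _ Pst irr pI); under [LHS]eq_bigr do rewrite mxE.
  rewrite exchange_big/=; apply: eq_bigr => z _.
  rewrite -mulr_sumr; congr (_ * _).
  under [LHS]eq_bigr do rewrite mxE [X in _ + X]mxE.
  rewrite sumrB; congr (_ - _).
  rewrite (bigD1 z)//= mxE eqxx big1 ?addr0// => y yx.
  by rewrite mxE eq_sym (negbTE yx).
apply: ler_sum => z _; rewrite (le_trans (ler_norm _))// normrM.
rewrite ler_piMr// ger0_norm ?subr_ge0 ?taboo_mass_le1//.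
by rewrite gerBl taboo_mass_ge0.
Qed.

Lemma taboo_mass_cvg (R : realType) (d : nat) (P : 'M[R]_d)
    (p : 'rV[R]_d) a x :
  is_stochastic P -> is_irreducible P -> is_invariant_pmf P p ->
  taboo_mass P a ^~ x @ \oo --> (0 : R).
Proof.
move=> Pst irr pI; apply: cvg_series_cvg_0.
have [B SB] := taboo_mass_series_bounded a x Pst irr pI.
apply: nondecreasing_is_cvgn.
  by apply: nondecreasing_series => n _ _; exact: taboo_mass_ge0.
by exists B => _ [n _ <-]; rewrite /series/= big_mkord.
Qed.

(** The Green operator of the chain killed at [a], that is, the sum over t of T^t f, written in
    closed form. *)
Definition taboo_potential (R : realType) (d : nat) (P : 'M[R]_d) a
    (f : 'I_d -> R) x : R :=
  \sum_y invmx (1%:M - taboo P a) x y * f y.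

(** The partial sums miss the potential by [V] T^n f, and T^n f is dominated by the survival
    probability times the sum of [|f|]. *)
Lemma taboo_series_cvg (R : realType) (d : nat) (P : 'M[R]_d)
    (p : 'rV[R]_d) a (f : 'I_d -> R) x :
  is_stochastic P -> is_irreducible P -> is_invariant_pmf P p ->
  (fun n => \sum_(t < n) \sum_y (taboo P a ^+ t) x y * f y) @ \oo -->
    taboo_potential P a f x.
Proof.
move=> Pst irr pI; have [P0 P1] := Pst.
set V := invmx (1%:M - taboo P a).
have -> : (fun n => \sum_(t < n) \sum_y (taboo P a ^+ t) x y * f y) =
    (fun n => taboo_potential P a f x -
       \sum_z V x z * \sum_y (taboo P a ^+ n) z y * f y).
  apply/funext => n.
  transitivity (\sum_y taboo_sum P a n x y * f y).
    rewrite exchange_big/=; apply: eq_bigr => y _.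
    by rewrite /taboo_sum summxE mulr_suml.
  rewrite (taboo_sumE _ _ Pst irr pI) mulmxBr mulmx1 /taboo_potential.
  under [LHS]eq_bigr do rewrite mxE [X in _ + X]mxE mulrBl.
  rewrite sumrB; congr (_ - _).
  under [LHS]eq_bigr do rewrite mxE mulr_suml.
  rewrite exchange_big/=; apply: eq_bigr => z _.
  by rewrite mulr_sumr; apply: eq_bigr => y _; rewrite mulrA.
rewrite -[X in _ --> X]subr0; apply: cvgB; first exact: cvg_cst.
rewrite [X in _ --> X](_ : 0 = \sum_(z : 'I_d) V x z * 0); last first.
  by rewrite big1// => z _; rewrite mulr0.
apply: (cvg_big (@add_continuous R^o)) => z _.
apply: cvgM; first exact: cvg_cst.
pose M := \sum_y `|f y|.
have fM y : `|f y| <= M by rewrite /M (bigD1 y)//= lerDl sumr_ge0.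
apply/norm_cvg0P; apply: (@squeeze_cvgr _ _ _ _ (cst 0)
  (fun n => taboo_mass P a n z * M)).
- apply: nearW => n; rewrite normr_ge0/= /taboo_mass mulr_suml.
  rewrite (le_trans (ler_norm_sum _ _ _))//; apply: ler_sum => y _.
  have T0 : 0 <= (taboo P a ^+ n) z y.
    by apply: expmx_ge0 => i j; exact: taboo_ge0.
  by rewrite normrM (ger0_norm T0) ler_wpM2l.
- exact: cvg_cst.
- rewrite -[X in _ --> X](mul0r M); apply: cvgM; last exact: cvg_cst.
  exact: taboo_mass_cvg irr pI.
Qed.

(* The regeneration identity h = f + T h, with T the taboo kernel, gives
   h - P h = f - h(a) P(., a); averaging under the invariant law forces
   h(a) = 0 when f is centered. *)
Lemma poisson_equation (R : realType) (d : nat) (P : 'M[R]_d)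
    (p : 'rV[R]_d) a (U : 'I_d -> R) x :
  is_stochastic P -> is_irreducible P -> is_invariant_pmf P p ->
  let h := taboo_potential P a (centered U p) in
  h x - \sum_y P x y * h y = centered U p x.
Proof.
move=> Pst irr pI h; have p_gt0 := invariant_pmf_gt0 Pst irr pI.
have V := taboo_unitmx a Pst irr pI.
set f := centered U p.
have hE z : h z - \sum_y P z y * h y = f z - P z a * h a.
  pose fc := \col_i f i; pose hc := \col_i h i.
  have hcE : hc = invmx (1%:M - taboo P a) *m fc.
    by apply/colP => i; rewrite !mxE; apply: eq_bigr => y _; rewrite [fc _ _]mxE.
  have : (1%:M - taboo P a) *m hc = fc by rewrite hcE mulKVmx.
  rewrite mulmxBl mul1mx => /colP /(_ z); rewrite !mxE => <-.
  rewrite -addrA -opprD; congr (_ - _).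
  rewrite (bigD1 a)//= [in RHS](bigD1 a)//= !mxE eqxx mulr0n mul0r add0r addrC.
  by congr (_ + _); apply: eq_bigr => y ya; rewrite !mxE ya mulr1n.
clearbody h; have [[_ p1] pP] := pI.
suff ha : h a = 0 by rewrite hE ha mulr0 subr0.
have : \sum_z p 0 z * (h z - \sum_y P z y * h y) = 0.
  under [LHS]eq_bigr do rewrite mulrBr mulr_sumr.
  rewrite sumrB exchange_big/= -sumrB big1// => y _.
  under eq_bigr do rewrite mulrA.
  by rewrite -mulr_suml -{1}pP mxE subrr.
under eq_bigr do rewrite hE mulrBr mulrA.
rewrite sumrB -mulr_suml.
have -> : \sum_i p 0 i * P i a = p 0 a by rewrite -{2}pP mxE.
have -> : \sum_i p 0 i * f i = 0.
  rewrite /f /centered; under [LHS]eq_bigr do rewrite mulrBr.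
  by rewrite sumrB -mulr_suml p1 mul1r subrr.
by rewrite sub0r => /eqP; rewrite oppr_eq0 mulf_eq0 gt_eqF//= => /eqP.
Qed.

(** * Excursions of the Markov chain *)

Section FiniteEvents.
Context (R : realType) (disp : measure_display) (Omega : measurableType disp).
Variable Pr : probability Omega R.

Lemma integral_indic_comb (I : finType) (c : I -> R) (E : I -> set Omega) :
  (forall i, measurable (E i)) ->
  Pr.-integrable setT (EFin \o (fun w => \sum_i c i * \1_(E i) w)) /\
  (\int[Pr]_w (\sum_i c i * \1_(E i) w)%:E =
    (\sum_i c i * fine (Pr (E i)))%:E)%E.
Proof.
move=> mE; rewrite /comp; elim: (index_enum I) => [|i s [IH1 IH2]].
  have -> : (fun w => (\sum_(i <- [::]) c i * \1_(E i) w)%:E) =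
      cst (0%E : \bar R) by apply/funext => w; rewrite big_nil.
  by split; [exact: integrable0|rewrite integral0 big_nil].
have ci : (fun w => (c i * \1_(E i) w)%:E) =
  (fun w => (c i)%:E * (\1_(E i) w)%:E)%E by apply/funext => w; rewrite EFinM.
have ii : Pr.-integrable setT (EFin \o (fun w => c i * \1_(E i) w)).
  by rewrite /comp ci; apply: integrableZl => //; exact: integrable_indic.
have -> : (fun w => (\sum_(j <- i :: s) c j * \1_(E j) w)%:E) =
    (fun w => (c i * \1_(E i) w)%:E + (\sum_(j <- s) c j * \1_(E j) w)%:E)%E.
  by apply/funext => w; rewrite big_cons EFinD.
split; first exact: integrableD.
rewrite integralD_EFin// IH2 big_cons EFinD; congr (_ + _)%E.
rewrite /comp ci integralZl//; last exact: integrable_indic.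
by rewrite integral_indic// setIT EFinM fineK// fin_num_measure.
Qed.

Lemma measurable_fiber (I : finType) (Y : Omega -> I) (B : pred I) :
  (forall i, measurable [set w | Y w = i]) -> measurable [set w | B (Y w)].
Proof.
move=> mY.
have -> : [set w | B (Y w)] = \bigcup_(i in [set i | B i]) [set w | Y w = i].
  by apply/seteqP; split => [w Bw|w [i Bi] /= ->//]; exists (Y w).
exact: fin_bigcup_measurable.
Qed.

(** The indicator of [S] is the sum of the indicators of its slices along [Y]; integrate both
    sides. *)
Lemma probability_partition (I : finType) (Y : Omega -> I) (S : set Omega) :
  measurable S -> (forall i, measurable [set w | Y w = i]) ->
  fine (Pr S) = \sum_i fine (Pr (S `&` [set w | Y w = i])).
Proof.
move=> mS mY; have mE i : measurable (S `&` [set w | Y w = i]).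
  exact: measurableI.
have [_] := integral_indic_comb (fun=> 1) mE.
have -> : (fun w => (\sum_i 1 * \1_(S `&` [set w | Y w = i]) w)%:E) =
    (fun w => (\1_S w)%:E) :> (Omega -> \bar R).
  apply/funext => w; rewrite (bigD1 (Y w))//= big1 ?addr0 => [|i iY].
    by rewrite mul1r indicI/= [X in _ * X]indicE mem_set// mulr1.
  by rewrite indicE memNset ?mulr0//= => -[_] /esym/eqP; exact/negP.
rewrite integral_indic ?setIT// => ->.
by apply: eq_bigr => i _; rewrite mul1r.
Qed.

Lemma probability_fiber (I : finType) (Y : Omega -> I) (B : pred I) :
  (forall i, measurable [set w | Y w = i]) ->
  fine (Pr [set w | B (Y w)]) = \sum_(i | B i) fine (Pr [set w | Y w = i]).
Proof.
move=> mY; rewrite (probability_partition (measurable_fiber B mY) mY).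
rewrite [RHS]big_mkcond; apply: eq_bigr => i _.
case: ifPn => Bi; last first.
  rewrite (_ : _ `&` _ = set0) ?measure0//.
  by apply/seteqP; split => // w [/=] + wi; rewrite wi (negbTE Bi).
congr (fine (Pr _)); apply/seteqP; split => w /=; first by case.
by move=> wi; rewrite wi.
Qed.

End FiniteEvents.

Section KilledChain.
Context (R : realType) (d : nat) (disp : measure_display).
Context (Omega : measurableType disp) (Pr : probability Omega R).
Context (P : 'M[R]_d) (a x : 'I_d) (X : nat -> Omega -> 'I_d).
Hypothesis XP : is_markov_chain Pr P x X.

Let mX t y : measurable [set w | X t w = y].
Proof. by case: XP. Qed.

(** The past is encoded in a finite type, so that any event it determines is a finite disjoint union
    of path events. *)
Definition history n w : {ffun 'I_n.+1 -> 'I_d} := [ffun i => X (nat_of_ord i) w].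

Lemma measurable_path_event p n : measurable (path_event X p n).
Proof.
elim: n => [|n IHn].
  rewrite (_ : path_event _ _ _ = [set w | X 0 w = p 0%N])//.
  by apply/seteqP; split => [w|w /= h t]; [exact|rewrite leqn0 => /eqP ->].
rewrite (_ : path_event _ _ _ = path_event X p n `&` [set w | X n.+1 w = p n.+1]).
  exact: measurableI.
apply/seteqP; split => [w h|w [h1 h2] t].
  by split; [move=> t tn; apply: h; exact: leqW|exact: h].
by rewrite leq_eqVlt => /predU1P[->//|]; exact: h1.
Qed.

Lemma historyE n g :
  [set w | history n w = g] = path_event X (fun t => g (inord t)) n.
Proof.
apply/seteqP; split => [w <- t tn|w h]; first by rewrite ffunE inordK.
by apply/ffunP => i; rewrite ffunE h ?inord_val// -ltnS.
Qed.

Let mH n g : measurable [set w | history n w = g].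
Proof. by rewrite historyE; exact: measurable_path_event. Qed.

Lemma history_step n g y :
  fine (Pr [set w | (history n w, X n.+1 w) = (g, y)]) =
  fine (Pr [set w | history n w = g]) * P (g ord_max) y.
Proof.
pose p t := if (t <= n)%N then g (inord t) else y.
have E1 : [set w | (history n w, X n.+1 w) = (g, y)] = path_event X p n.+1.
  apply/seteqP; split => [w [hg hy] t|w h].
    rewrite /p leq_eqVlt => /predU1P[->|]; first by rewrite ltnn.
    by rewrite ltnS => tn; rewrite tn -hg ffunE inordK.
  congr (_, _); last by rewrite h// /p ltnn.
  apply/ffunP => i; have ilen : (i <= n)%N by rewrite -ltnS.
  by rewrite ffunE h ?leqW// /p ilen inord_val.
have E2 : [set w | history n w = g] = path_event X p n.
  rewrite historyE; apply/seteqP; split => w h t tn; rewrite h// /p tn//.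
case: XP => _ _ mk; rewrite E1 E2 mk fineM//.
  rewrite /p leqnn ltnn /=; congr (_ * P (g _) _).
  by apply/val_inj; rewrite /= inordK.
by rewrite fin_num_measure//; exact: measurable_path_event.
Qed.

(** The Markov property for events decided by the past: sum [history_step] over the histories in
    [A], grouped by their last state. *)
Lemma markov_step n (A : pred {ffun 'I_n.+1 -> 'I_d}) y :
  fine (Pr [set w | A (history n w) /\ X n.+1 w = y]) =
  \sum_z fine (Pr [set w | A (history n w) /\ X n w = z]) * P z y.
Proof.
have mHX (u : {ffun 'I_n.+1 -> 'I_d} * 'I_d) :
    measurable [set w | (history n w, X n.+1 w) = u].
  case: u => g z; rewrite (_ : mkset _ =
      [set w | history n w = g] `&` [set w | X n.+1 w = z]).
    exact: measurableI.
  by apply/seteqP; split => w /=; [case=> -> ->|case=> -> ->].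
have -> : [set w | A (history n w) /\ X n.+1 w = y] =
    [set w | [pred u : {ffun 'I_n.+1 -> 'I_d} * 'I_d | A u.1 && (u.2 == y)]
               (history n w, X n.+1 w)].
  apply/seteqP; split => w /=; first by case=> -> ->; rewrite eqxx.
  by case/andP => -> /eqP.
rewrite (probability_fiber _ _ mHX).
transitivity (\sum_(g | A g) \sum_(z | z == y)
    fine (Pr [set w | (history n w, X n.+1 w) = (g, z)])).
  by rewrite pair_big/=; apply: eq_bigr; case.
under eq_bigr do rewrite big_pred1_eq history_step.
rewrite (partition_big (fun g : {ffun 'I_n.+1 -> 'I_d} => g ord_max) xpredT)//=.
apply: eq_bigr => z _.
have -> : [set w | A (history n w) /\ X n w = z] =
    [set w | [pred g : {ffun 'I_n.+1 -> 'I_d} | A g && (g ord_max == z)]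
               (history n w)].
  apply/seteqP; split => w /=; rewrite ffunE/=.
    by case=> -> ->; rewrite eqxx.
  by case/andP => -> /eqP.
rewrite (probability_fiber _ _ (@mH n)) mulr_suml.
by apply: eq_bigr => g /andP[_ /eqP ->].
Qed.

(** Time 0 is excluded, as in the return time, so a chain started at [a] also has a nontrivial
    excursion. *)
Definition avoids n w := forall t, (0 < t <= n)%N -> X t w != a.

Let avoids_hist n : pred {ffun 'I_n.+1 -> 'I_d} :=
  fun g => [forall i : 'I_n.+1, (0 < i)%N ==> (g i != a)].

Let avoids_histP n w : avoids n w <-> avoids_hist (history n w).
Proof.
split => [h|/forallP h t /andP[t0 tn]].
  apply/forallP => i; apply/implyP => i0; rewrite ffunE; apply: h.
  by rewrite i0 -ltnS/=.
by have := h (inord t); rewrite ffunE inordK// t0.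
Qed.

Lemma measurable_avoids n y : measurable [set w | avoids n w /\ X n w = y].
Proof.
rewrite (_ : mkset _ = [set w | avoids_hist (history n w)] `&` [set w | X n w = y]).
  by apply: measurableI => //; exact: (measurable_fiber _ (@mH n)).
by apply/seteqP; split => w /=; rewrite avoids_histP.
Qed.

(** Induction on [n]: a step into [a] contributes nothing, which is the zeroed column of [taboo],
    and any other step follows [P] by [markov_step]. *)
Lemma probability_avoids n y :
  fine (Pr [set w | avoids n w /\ X n w = y]) = (taboo P a ^+ n) x y.
Proof.
elim: n y => [|n IHn] y.
  rewrite expr0 mxE.
  have -> : [set w | avoids 0 w /\ X 0 w = y] = [set w | X 0 w = y].
    by apply/seteqP; split => w /=; [case|split=> // t; case: t].
  have [_ X0 _] := XP; have [<-|xy] := eqVneq x y; first by rewrite X0.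
  (* Starting elsewhere than at [x] is contained in the complement of an almost sure event. *)
  suff -> : Pr [set w | X 0 w = y] = 0%E by [].
  apply/eqP; rewrite eq_le measure_ge0 andbT.
  have <- : Pr (~` [set w | X 0 w = x]) = 0%E.
    by rewrite probability_setC// X0 subee.
  apply: le_measure; rewrite ?inE//; first exact: measurableC.
  by move=> w /= -> yx; move: xy; rewrite yx eqxx.
rewrite exprSr -mulmxE mxE.
under eq_bigr do rewrite -IHn mxE.
have [->|ya] := eqVneq y a.
  under eq_bigr do rewrite mulr0n mulr0.
  rewrite big1// (_ : mkset _ = set0) ?measure0//.
  apply/seteqP; split => // w [h Xa]; have := h n.+1.
  by rewrite ltnSn Xa eqxx => /(_ isT).
under eq_bigr do rewrite mulr1n.
have -> : [set w | avoids n.+1 w /\ X n.+1 w = y] =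
    [set w | avoids_hist (history n w) /\ X n.+1 w = y].
  apply/seteqP; split => w /= [h Xy]; split => //.
    by apply/avoids_histP => t /andP[t0 tn]; apply: h; rewrite t0 leqW.
  move=> t /andP[t0]; rewrite leq_eqVlt => /predU1P[->|tn]; first by rewrite Xy.
  by move/avoids_histP : h; apply; rewrite t0.
rewrite markov_step; apply: eq_bigr => z _; congr (fine (Pr _) * _).
by apply/seteqP; split => w /= [h ?]; split=> //; exact/avoids_histP.
Qed.

(** The existence of a return must be kept on the right, since [return_time] takes the default value
    0 on paths that never return. *)
Lemma lt_return_time n w : (n < return_time X a w)%N <->
  avoids n w /\ exists2 t, (0 < t)%N & X t w = a.
Proof.
rewrite /return_time; case: pselect => [e|ne]; last first.
  by split => // -[_ [t t0 Xt]]; exfalso; apply: ne; exists t; rewrite t0 Xt eqxx.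
case: ex_minnP => m /andP[m0 /eqP Xm] mmin; split => [nm|[av _]].
  split; last by exists m.
  move=> t /andP[t0 tn]; apply/negP => Xt.
  by have := mmin t; rewrite t0 Xt => /(_ isT); rewrite leqNgt (leq_ltn_trans tn).
by rewrite ltnNge; apply/negP => mn; have := av m; rewrite m0 mn Xm eqxx => /(_ isT).
Qed.

Let returns : set Omega := [set w | exists2 t, (0 < t)%N & X t w = a].

Let measurable_returns : measurable returns.
Proof.
rewrite (_ : returns = \bigcup_t [set w | X t.+1 w = a]).
  exact: bigcupT_measurable.
apply/seteqP; split => w /=; last by case=> t _ Xt; exists t.+1.
by case=> -[//|t] _ Xt; exists t.
Qed.

Hypothesis Pst : is_stochastic P.
Hypothesis Pirr : is_irreducible P.
Variable p : 'rV[R]_d.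
Hypothesis pI : is_invariant_pmf P p.

(** Never returning implies avoiding [a] up to every time [n], and these survival probabilities tend
    to 0. *)
Lemma probability_never_returns : Pr (~` returns) = 0%E.
Proof.
have mN : measurable (~` returns) by exact: measurableC.
rewrite -[LHS]fineK ?fin_num_measure//; congr (_%:E).
apply/eqP; rewrite eq_le; apply/andP; split; last exact: fine_ge0.
apply: (cvgr_to_ge (taboo_mass_cvg a x Pst Pirr pI)).
apply: nearW => n.
rewrite (probability_partition Pr mN (mX n)).
apply: ler_sum => y _; rewrite -probability_avoids.
have mNy : measurable (~` returns `&` [set w | X n w = y]).
  exact: measurableI.
have mA := measurable_avoids n y.
rewrite fine_le ?fin_num_measure// le_measure ?inE//.
move=> w [/= h Xy]; split => // t /andP[t0 _]; apply/eqP => Xt.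
by apply: h; exists t.
Qed.

Definition excursion_at t y : set Omega :=
  [set w | (t < return_time X a w)%N /\ X t w = y].

Lemma excursion_atE t y :
  excursion_at t y = [set w | avoids t w /\ X t w = y] `&` returns.
Proof.
apply/seteqP; split => w /=; first by case=> /lt_return_time[? ?] ?.
by case=> -[? ?] ?; split => //; exact/lt_return_time.
Qed.

Lemma measurable_excursion_at t y : measurable (excursion_at t y).
Proof.
rewrite excursion_atE; apply: measurableI => //; exact: measurable_avoids.
Qed.

(** The default value of [return_time] changes the avoidance event only on the null set of paths
    without return. *)
Lemma probability_excursion_at t y :
  fine (Pr (excursion_at t y)) = (taboo P a ^+ t) x y.
Proof.
rewrite -probability_avoids excursion_atE; congr fine.
have mA := measurable_avoids t y.
rewrite [RHS](measureDI Pr mA measurable_returns).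
rewrite [X in (X + _)%E](_ : _ = 0%E) ?add0e//.
apply/eqP; rewrite eq_le measure_ge0 andbT -probability_never_returns.
apply: le_measure; rewrite ?inE; [exact: measurableD|exact: measurableC|].
by move=> w [].
Qed.

Lemma stopped_sumE (f : 'I_d -> R) n w :
  \sum_(u : 'I_n * 'I_d) f u.2 * \1_(excursion_at u.1 u.2) w =
  \sum_(0 <= t < n | (t < return_time X a w)%N) f (X t w).
Proof.
rewrite -(pair_bigA _ (fun (t : 'I_n) y => f y * \1_(excursion_at t y) w))/=.
rewrite big_mkord [RHS]big_mkcond; apply: eq_bigr => t _.
rewrite (bigD1 (X t w))//= big1 ?addr0 => [|y yX]; last first.
  by rewrite indicE memNset ?mulr0//= => -[_] /esym/eqP; exact/negP.
case: ifPn => tr; first by rewrite indicE mem_set ?mulr1.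
by rewrite indicE memNset ?mulr0// => -[/(negP tr)].
Qed.

(** Dominated convergence for the sums truncated at time [n]: their expectations are the partial
    sums in [taboo_series_cvg]. *)
Lemma expectation_excursion (f : 'I_d -> R) :
  fine (expectation Pr (fun w => \sum_(0 <= t < return_time X a w) f (X t w)))
  = taboo_potential P a f x.
Proof.
pose M := \sum_y `|f y|.
have fM y : `|f y| <= M by rewrite /M (bigD1 y)//= lerDl sumr_ge0.
have M0 : 0 <= M by exact: sumr_ge0.
pose g n w : R := \sum_(u : 'I_n * 'I_d) f u.2 * \1_(excursion_at u.1 u.2) w.
pose h t w : R := \sum_y M * \1_(excursion_at t y) w.
have mE t := measurable_excursion_at t.
have gI n := integral_indic_comb Pr (fun u : 'I_n * 'I_d => f u.2)
  (fun u => mE u.1 u.2).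
have hI t := integral_indic_comb Pr (fun=> M) (mE t).
have hE t w : h t w = if (t < return_time X a w)%N then M else 0.
  rewrite /h (bigD1 (X t w))//= big1 ?addr0 => [|y yX]; last first.
    by rewrite indicE memNset ?mulr0//= => -[_] /esym/eqP; exact/negP.
  case: ifPn => tr; first by rewrite indicE mem_set ?mulr1.
  by rewrite indicE memNset ?mulr0// => -[/(negP tr)].
have h0 t w : (0 <= (h t w)%:E)%E by rewrite lee_fin hE; case: ifP.
pose Z w : R := \sum_(0 <= t < return_time X a w) f (X t w).
have gZ w n : (return_time X a w <= n)%N -> g n w = Z w.
  by move=> rn; rewrite /g stopped_sumE /Z (big_nat_widen _ _ _ _ _ rn).
have gcvg w : (fun n => (g n w)%:E) @ \oo --> (Z w)%:E.
  apply: cvg_near_cst; exists (return_time X a w) => // n /= rn.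
  by rewrite gZ.
have mg n : measurable_fun setT (EFin \o g n).
  by have [/integrableP[]] := gI n.
have mh t : measurable_fun setT (EFin \o h t).
  by have [/integrableP[]] := hI t.
have mZ : measurable_fun setT (EFin \o Z).
  apply: (emeasurable_fun_cvg (fun n => EFin \o g n)) => // w _.
  exact: gcvg.
(* The dominating function is [M] times the return time, integrable by the bound on the sums of
   survival probabilities. *)
pose D w : \bar R := (\sum_(0 <= t <oo) (h t w)%:E)%E.
have mD : measurable_fun setT D.
  have := @ge0_emeasurable_sum _ _ _ setT (fun t => EFin \o h t) xpredT.
  by apply => [t w _ _|t _]; [exact: h0|exact: mh].
have gD n w : (`|(g n w)%:E| <= D w)%E.
  apply: (@le_trans _ _ (\sum_(0 <= t < n) (h t w)%:E)%E); last first.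
    by apply: nneseries_lim_ge => t _ _.
  rewrite abse_EFin sumEFin lee_fin /g stopped_sumE.
  rewrite (le_trans (ler_norm_sum _ _ _))// big_mkcond/=.
  by apply: ler_sum => t _; rewrite hE; case: ifP.
have ID : Pr.-integrable setT D.
  apply/integrableP; split => //.
  have D0 w : (0 <= D w)%E by apply: nneseries_ge0.
  rewrite (eq_integral D) => [|w _]; last by rewrite gee0_abs.
  rewrite integral_nneseries//.
  have [B SB] := taboo_mass_series_bounded a x Pst Pirr pI.
  apply: (@le_lt_trans _ _ (M * B)%:E); last exact: ltry.
  apply: lime_le; first by apply: is_cvg_nneseries => t _ _; exact: integral_ge0.
  apply: nearW => n.
  rewrite (eq_bigr (fun t => (M * taboo_mass P a t x)%:E)) => [|t _]; last first.
    rewrite (hI t).2 -mulr_sumr; congr ((_ * _)%:E).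
    by apply: eq_bigr => y _; exact: probability_excursion_at.
  by rewrite sumEFin lee_fin -mulr_sumr big_mkord ler_wpM2l.
have [_ _] := dominated_convergence measurableT mg mZ
  (aeW _ (fun w _ => gcvg w)) ID (aeW _ (fun w n _ => gD n w)).
have -> : (fun n => \int[Pr]_w (g n w)%:E)%E = (fun n =>
    (\sum_(t < n) \sum_y (taboo P a ^+ t) x y * f y)%:E).
  apply/funext => n; rewrite (gI n).2; congr (_%:E).
  rewrite [RHS]pair_bigA; apply: eq_bigr => u _.
  by rewrite probability_excursion_at mulrC.
have S := @taboo_series_cvg _ _ _ _ a f x Pst Pirr pI.
move=> ZS; suff ZE : (\int[Pr]_w (Z w)%:E)%E = (taboo_potential P a f x)%:E.
  by rewrite unlock [X in fine X]ZE.
by apply: (cvg_unique _ ZS) => //; apply: cvg_EFin => //; exact: nearW.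
Qed.

End KilledChain.

(** * Perturbation of the Perron eigenvector *)

(** From e^(-a) >= 1 - a one gets e^a <= 1/(1 - a), and (1 + a + 2a^2)(1 - a) = 1 + a^2 (1 - 2a) >=
    1. *)
Lemma expR_le_quadratic (R : realType) (a : R) :
  a <= 1 / 2 -> expR a <= 1 + a + 2 * a ^+ 2.
Proof.
move=> a2; have := expR_ge1Dx (- a); rewrite expRN => h.
have a1 : 0 < 1 - a by lra.
have e1 : expR a <= (1 - a)^-1.
  by rewrite -[leLHS]invrK lef_pV2// posrE invr_gt0 expR_gt0.
apply: (le_trans e1); rewrite -[_^-1]mul1r ler_pdivrMr//.
by nra.
Qed.

(** Here e^(-2c) <= 1/(1 + 2c) <= 1 - c, because (1 - c)(1 + 2c) = 1 + c (1 - 2c) >= 1. *)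
Lemma ln_ge_linear (R : realType) (c t : R) :
  0 <= c -> c <= 1 / 2 -> 1 - c <= t -> - (2 * c) <= ln t.
Proof.
move=> c0 c2 ct; have t0 : 0 < t by lra.
rewrite -ler_expR lnK ?posrE// expRN (le_trans _ ct)//.
have h := expR_ge1Dx (2 * c).
have e1 : (expR (2 * c))^-1 <= (1 + 2 * c)^-1.
  by rewrite lef_pV2 ?posrE ?expR_gt0//; lra.
apply: (le_trans e1); rewrite -[_^-1]mul1r ler_pdivrMr; nra.
Qed.

Section PerturbedKernel.
Context (R : realType) (d : nat) (P : 'M[R]_d) (Gm : 'I_d -> 'I_d -> R).
Hypothesis Pst : is_stochastic P.
Hypothesis Pirr : is_irreducible P.
Hypothesis Gm0 : forall x, \sum_y P x y * Gm x y = 0.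

(** [G] bounds every entry of [Gm], [delta] keeps the exponents [z * Gm x y] within 1/2, and [K] is
    the resulting coefficient of the second-order term. *)
Let G : R := \sum_x \sum_y `|Gm x y|.
Let K : R := 2 * G ^+ 2.
Let delta : R := (2 * (G + 1))^-1.

Let P0 x y : 0 <= P x y. Proof. by case: Pst. Qed.
Let P1 x : \sum_y P x y = 1. Proof. by case: Pst. Qed.

Let G0 : 0 <= G.
Proof. by apply: sumr_ge0 => x _; exact: sumr_ge0. Qed.

Let GmG x y : `|Gm x y| <= G.
Proof.
rewrite /G (bigD1 x)//= (bigD1 y)//= -addrA lerDl addr_ge0 ?sumr_ge0//.
by move=> i _; exact: sumr_ge0.
Qed.

Let delta0 : 0 < delta.
Proof. by rewrite invr_gt0 mulr_gt0 ?ltr_wpDl. Qed.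

Let zG (z : R) : `|z| <= delta -> `|z| * G <= 1 / 2.
Proof.
move=> zd; have : `|z| * (2 * (G + 1)) <= 1.
  by rewrite -ler_pdivlMr ?mul1r// mulr_gt0 ?ltr_wpDl.
by have := normr_ge0 z; nra.
Qed.

Let zGm (z : R) x y : `|z| <= delta -> `|z * Gm x y| <= 1 / 2.
Proof.
move=> zd; rewrite normrM (le_trans _ (zG zd))//.
exact: ler_wpM2l.
Qed.

(** The first-order term vanishes because [Gm] has mean zero along each row of [P]. *)
Let row_sum_le (z : R) x : `|z| <= delta ->
  \sum_y P x y * expR (z * Gm x y) <= 1 + K * z ^+ 2.
Proof.
move=> zd.
apply: (@le_trans _ _ (\sum_y (P x y + z * (P x y * Gm x y) +
    P x y * (K * z ^+ 2)))).
  apply: ler_sum => y _.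
  have h1 : z * Gm x y <= 1 / 2 by rewrite (le_trans (ler_norm _))// zGm.
  have h2 : Gm x y ^+ 2 <= G ^+ 2.
    by rewrite -[Gm x y ^+ 2]real_normK ?num_real// lerXn2r ?nnegrE.
  have h3 := expR_le_quadratic h1.
  have h4 : expR (z * Gm x y) <= 1 + z * Gm x y + K * z ^+ 2.
    apply: (le_trans h3); rewrite lerD2l exprMn /K.
    by have := sqr_ge0 z; nra.
  apply: (le_trans (ler_wpM2l (P0 x y) h4)).
  by rewrite le_eqVlt; apply/orP; left; apply/eqP; ring.
by rewrite !big_split/= -mulr_sumr -mulr_suml Gm0 P1 mulr0 addr0 mul1r.
Qed.

Let row_sum_ge (z : R) x : 1 <= \sum_y P x y * expR (z * Gm x y).
Proof.
apply: (@le_trans _ _ (\sum_y (P x y + z * (P x y * Gm x y)))).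
  by rewrite big_split/= -mulr_sumr Gm0 P1 mulr0 addr0.
apply: ler_sum => y _; have := ler_wpM2l (P0 x y) (expR_ge1Dx (z * Gm x y)).
by apply: le_trans; rewrite le_eqVlt; apply/orP; left; apply/eqP; ring.
Qed.

Section Eigen.
Variables (z mu : R) (g : 'I_d -> R).
Hypothesis zd : `|z| <= delta.
Hypothesis g0 : forall x, 0 < g x.
Hypothesis gE : forall x, \sum_y P x y * expR (z * Gm x y) * g y = mu * g x.

(** Evaluate the eigenvalue equation where [g] is minimal for the lower bound and where it is
    maximal for the upper bound; [mu] is thereby compared with row sums. *)
Lemma perturbed_eigenvalue_bounds (x0 : 'I_d) : 1 <= mu <= 1 + K * z ^+ 2.
Proof.
apply/andP; split.
  have [c cmin] := ex_argmin x0 g.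
  rewrite -(ler_pM2r (g0 c)) -gE.
  apply: (le_trans (ler_wpM2r (ltW (g0 c)) (row_sum_ge z c))).
  rewrite mulr_suml; apply: ler_sum => y _.
  by rewrite ler_wpM2l ?mulr_ge0 ?expR_ge0 ?cmin.
have [c cmax] := ex_argmax x0 g.
rewrite -(ler_pM2r (g0 c)) -gE.
apply: (le_trans _ (ler_wpM2r (ltW (g0 c)) (row_sum_le c zd))).
rewrite mulr_suml; apply: ler_sum => y _.
by rewrite ler_wpM2l ?mulr_ge0 ?expR_ge0 ?cmax.
Qed.

(** Apply the perturbed kernel to the deficit [M - g]. All terms are nonnegative, and the one at [y]
    has weight at least [P x y / 2] since the exponent is at least -1/2. The total is the row sum
    times [M] minus [mu * g x], where [mu >= 1]. *)
Lemma perturbed_step M x y : (forall i, g i <= M) ->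
  P x y / 2 * (M - g y) <= K * z ^+ 2 * M + (M - g x).
Proof.
move=> gM; have /andP[mu1 _] := perturbed_eigenvalue_bounds x.
have M0 : 0 < M := lt_le_trans (g0 x) (gM x).
apply: (@le_trans _ _ (\sum_w P x w * expR (z * Gm x w) * (M - g w))).
  rewrite (bigD1 y)//= -[leLHS]addr0 lerD//; last first.
    by apply: sumr_ge0 => w _; rewrite !mulr_ge0 ?expR_ge0// subr_ge0.
  rewrite ler_wpM2r ?subr_ge0// ler_wpM2l//.
  have := expR_ge1Dx (z * Gm x y); have := zGm x y zd.
  by rewrite ler_norml => /andP[]; lra.
under eq_bigr do rewrite mulrBr.
rewrite sumrB gE -mulr_suml.
have := ler_wpM2r (ltW M0) (row_sum_le x zd).
by have := g0 x; nra.
Qed.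

End Eigen.

(* A Harnack-type inequality: by irreducibility the deficit of g below an upper
   bound M propagates from x to y up to an error of order z^2. *)
Lemma perturbed_deficit x y : exists2 C : R, 0 <= C &
  forall (z mu : R) (g : 'I_d -> R) (M : R), `|z| <= delta -> (forall i, 0 < g i) ->
    (forall i, \sum_j P i j * expR (z * Gm i j) * g j = mu * g i) ->
    (forall i, g i <= M) -> M - g y <= C * ((M - g x) + z ^+ 2 * M).
Proof.
move: y; apply: (irreducible_closed P0 Pirr (x := x)).
  exists 1 => // z mu g M _ g0 _ gM; rewrite mul1r lerDl mulr_ge0 ?sqr_ge0//.
  exact: ltW (lt_le_trans (g0 x) (gM x)).
(* One more transition multiplies the bound by 2 / [P u w], and the added [K] absorbs the new error
   [K * z ^+ 2 * M]. *)
move=> u w [C C0 HC] Puw; exists (2 * (K + C) / P u w).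
  by rewrite divr_ge0 ?mulr_ge0 ?addr_ge0// /K mulr_ge0 ?sqr_ge0.
move=> z mu g M zd g0 gE gM.
have st := perturbed_step zd g0 gE u w gM.
have := HC z mu g M zd g0 gE gM.
have M0 : 0 < M := lt_le_trans (g0 x) (gM x).
have Mx : 0 <= M - g x by rewrite subr_ge0.
have K0 : 0 <= K by rewrite /K mulr_ge0 ?sqr_ge0.
set D := _ + z ^+ 2 * M => hu.
have KMx : 0 <= K * (M - g x) by exact: mulr_ge0.
rewrite -(ler_pM2r Puw).
have -> : 2 * (K + C) / P u w * D * P u w = 2 * (K + C) * D.
  by field; rewrite gt_eqF.
have -> : 2 * (K + C) * D = 2 * (K * (M - g x) + K * z ^+ 2 * M + C * D).
  by rewrite /D; ring.
by lra.
Qed.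

(** Take for [M] the maximum [g c]: the deficit at [c] is zero, so every [g i] is at least (1 - C
    z^2) [g c]. Logarithms of [g] thus differ by at most 2C z^2, and [ln mu] lies between 0 and K
    z^2. *)
Lemma perturbed_eigen_expansion : exists C e : R, [/\ 0 <= C, 0 < e &
  forall (z mu : R) (g : 'I_d -> R), `|z| <= e -> (forall i, 0 < g i) ->
    (forall i, \sum_j P i j * expR (z * Gm i j) * g j = mu * g i) ->
    forall x y, `|ln (g y) - ln (g x) - ln mu| <= C * z ^+ 2].
Proof.
have [C0 HC0] := choice (fun u : 'I_d * 'I_d => let: ex_intro2 C C0 H :=
  perturbed_deficit u.1 u.2 in ex_intro _ C (conj C0 H)).
(* Summing over the finitely many pairs of states gives one constant valid for all of them. *)
pose C := \sum_u C0 u.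
have CC u : C0 u <= C.
  by rewrite /C (bigD1 u)//= lerDl sumr_ge0// => i _; case: (HC0 i).
have Cge0 : 0 <= C by apply: sumr_ge0 => i _; case: (HC0 i).
have K0 : 0 <= K by rewrite /K mulr_ge0 ?sqr_ge0.
have e1 : 0 < (2 * (C + 1))^-1 by rewrite invr_gt0; nra.
exists (2 * C + K), (Num.min delta (2 * (C + 1))^-1); split.
- by nra.
- by rewrite lt_min delta0.
move=> z mu g; rewrite le_min => /andP[zd zC] g0 gE x y.
have [c gc] := ex_argmax x g.
have /andP[mu1 muK] := perturbed_eigenvalue_bounds zd g0 gE x.
have Cz : C * z ^+ 2 <= 1 / 2.
  have h : `|z| * (2 * (C + 1)) <= 1 by rewrite -ler_pdivlMr ?mul1r//; nra.
  rewrite -[z ^+ 2]real_normK ?num_real//; have := normr_ge0 z.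
  by nra.
have lng i : - (2 * (C * z ^+ 2)) <= ln (g i) - ln (g c) <= 0.
  rewrite -ln_div ?posrE//; apply/andP; split; last first.
    by apply: ln_le0; rewrite ler_pdivrMr// mul1r.
  apply: ln_ge_linear => //; first by rewrite mulr_ge0// sqr_ge0.
  rewrite ler_pdivlMr// mulrBl mul1r.
  have [_ /(_ z mu g (g c) zd g0 gE gc)] := HC0 (c, i).
  rewrite /= subrr add0r => h.
  have : C0 (c, i) * (z ^+ 2 * g c) <= C * (z ^+ 2 * g c).
    by rewrite ler_wpM2r// mulr_ge0 ?sqr_ge0// ltW.
  by rewrite mulrA in h *; lra.
have lnmu : 0 <= ln mu <= K * z ^+ 2.
  have /le_ln1Dx : -1 < mu - 1 by lra.
  rewrite [1 + _]addrC subrK ln_ge0// => lm.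
  by rewrite (le_trans lm)//; lra.
have /andP[x1 x2] := lng x; have /andP[y1 y2] := lng y.
case/andP: lnmu => m1 m2.
by rewrite ler_norml; apply/andP; split; lra.
Qed.

End PerturbedKernel.

(** * Second-order control of the controlled kernel near zero *)

Section ControlledKernel.
Context (R : realType) (d : nat) (P : 'M[R]_d) (U H : 'I_d -> R).
Context (p : 'rV[R]_d) (lam : R -> R) (v : R -> 'cV[R]_d).
Hypothesis Pst : is_stochastic P.
Hypothesis Pirr : is_irreducible P.
Hypothesis poisson : forall x, H x - \sum_y P x y * H y = centered U p x.
Hypothesis lam_gt0 : forall z, 0 < lam z.
Hypothesis v_gt0 : forall z x, 0 < v z x 0.
Hypothesis v_eigen : forall z, tiltedP U P z *m v z = lam z *: v z.

Let Pc := controlledP U P lam v.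

(* v_z is compared with the approximate eigenvector e^{z H}, and lambda_z with
   the approximate eigenvalue e^{z eta}. *)
Definition eigen_ratio z x := v z x 0 * expR (- (z * H x)).
Definition eigenvalue_ratio z := lam z * expR (- (z * mean U p)).

(** The exact correction to [z * Gamma] in the exponent of the controlled kernel. Only a difference
    of logarithms of [v z] enters, so the normalization of [v z], arbitrary for each [z],
    cancels. *)
Definition log_remainder x y z :=
  ln (eigen_ratio z y) - ln (eigen_ratio z x) - ln (eigenvalue_ratio z).

Let eigen_ratio_gt0 z x : 0 < eigen_ratio z x.
Proof. by rewrite mulr_gt0 ?expR_gt0. Qed.

(** Poisson's equation in the form required of [Gm] above. *)
Lemma Gamma_mean0 x : \sum_y P x y * Gamma U p H x y = 0.
Proof.
have [_ P1] := Pst; rewrite /Gamma -poisson.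
rewrite (eq_bigr (fun y => P x y * H y - P x y * \sum_y P x y * H y)).
  by rewrite sumrB -mulr_suml P1 mul1r subrr.
by move=> y _; ring.
Qed.

(** Conjugating the tilted matrix by e^(z H) and dividing by e^(z eta) leaves the kernel P e^(z
    Gamma), whose eigenpair is the pair of ratios. *)
Lemma eigen_ratioE z x :
  \sum_y P x y * expR (z * Gamma U p H x y) * eigen_ratio z y =
  eigenvalue_ratio z * eigen_ratio z x.
Proof.
have /colP/(_ x) := v_eigen z; rewrite mxE [RHS]mxE => e.
rewrite /eigenvalue_ratio /eigen_ratio mulrACA -e mulr_suml.
apply: eq_bigr => y _; rewrite mxE /Gamma /centered.
have -> : z * (U x - mean U p + H y - H x) =
  z * U x + z * H y - (z * mean U p) - z * H x by ring.
rewrite !expRD !expRN; field.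
by rewrite !gt_eqF ?expR_gt0.
Qed.

Lemma controlledP_exp z x y :
  Pc z x y = expR (z * Gamma U p H x y + log_remainder x y z) * P x y.
Proof.
have mu0 : 0 < eigenvalue_ratio z by rewrite mulr_gt0 ?expR_gt0.
rewrite !mxE expRD /log_remainder !expRD !expRN !lnK ?posrE//.
rewrite /eigenvalue_ratio /eigen_ratio /Gamma /centered.
have -> : z * (U x - mean U p + H y - H x) =
  z * U x + z * H y - (z * mean U p) - z * H x by ring.
rewrite !expRD !expRN; field.
by rewrite !gt_eqF ?expR_gt0 ?lam_gt0 ?v_gt0.
Qed.

Lemma log_remainder_bound : exists C e : R, [/\ 0 <= C, 0 < e &
  forall z x y, `|z| <= e -> `|log_remainder x y z| <= C * z ^+ 2].
Proof.
have [C [e [C0 e0 h]]] := perturbed_eigen_expansion Pst Pirr Gamma_mean0.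
exists C, e; split => // z x y ze; apply: h => //.
exact: eigen_ratioE.
Qed.

(** At z = 0 the quadratic bound forces the remainder to vanish. *)
Lemma controlledP0 : Pc 0 = P.
Proof.
have [C [e [_ e0 h]]] := log_remainder_bound.
apply/matrixP => x y; rewrite controlledP_exp mul0r add0r.
have := h 0 x y; rewrite normr0 ltW// => /(_ isT).
by rewrite expr0n/= mulr0 normr_le0 => /eqP ->; rewrite expR0 mul1r.
Qed.

(** With [b = z * g + r], the error is [P x y] times (e^b - 1 - b) + r, and both terms are quadratic
    in [z]. *)
Lemma controlledP_expansion : exists C e : R, [/\ 0 <= C, 0 < e &
  forall z x y, `|z| <= e ->
    `|Pc z x y - P x y - z * calE P U p H x y| <= C * `|z| ^+ 2].
Proof.
have [P0 _] := Pst.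
have [C [e [C0 e0 h]]] := log_remainder_bound.
pose Q : R := \sum_x \sum_y (`|Gamma U p H x y| + P x y).
have QG x y : `|Gamma U p H x y| + P x y <= Q.
  rewrite /Q (bigD1 x)//= (bigD1 y)//= -addrA lerDl addr_ge0 ?sumr_ge0//.
  - by move=> i _; rewrite addr_ge0.
  - by move=> i _; apply: sumr_ge0 => j _; rewrite addr_ge0.
have Q0 : 0 <= Q.
  by apply: sumr_ge0 => x _; apply: sumr_ge0 => y _; rewrite addr_ge0.
clearbody Q.
(* For [|z| <= e'] one has [|z| <= 1] and (Q + C)|z| <= 1/2, so that [b] is in the range of
   [expR_le_quadratic]. *)
pose e' : R := (2 * (Q + C + 1))^-1.
have e'0 : 0 < e' by rewrite invr_gt0; lra.
exists (Q * (2 * (Q + C) ^+ 2 + C)), (Num.min e e'); split.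
- by rewrite mulr_ge0// addr_ge0// mulr_ge0// sqr_ge0.
- by rewrite lt_min e0.
move=> z x y; rewrite le_min => /andP[ze ze'].
have zz := normr_ge0 z.
have hz : `|z| * (2 * (Q + C + 1)) <= 1.
  by rewrite -ler_pdivlMr ?mul1r//; lra.
have Qz : 0 <= (Q + C) * `|z| by rewrite mulr_ge0// addr_ge0.
have z1 : `|z| <= 1 by lra.
have hr : `|log_remainder x y z| <= C * `|z| ^+ 2.
  by rewrite real_normK ?num_real//; exact: h.
have QG' := QG x y; have Pxy := P0 x y.
have G0 := normr_ge0 (Gamma U p H x y).
set r := log_remainder x y z in hr *; set g := Gamma U p H x y in QG' G0 *.
pose b := z * g + r.
have hb : `|b| <= (Q + C) * `|z|.
  rewrite (le_trans (ler_normD _ _))// normrM mulrDl lerD//.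
    by rewrite mulrC ler_wpM2r//; lra.
  rewrite (le_trans hr)// ler_wpM2l// expr2 ler_piMr//.
have b2 : b <= 1 / 2 by rewrite (le_trans (ler_norm _))// (le_trans hb)//; lra.
have bb : `|b| ^+ 2 <= (Q + C) ^+ 2 * `|z| ^+ 2.
  by rewrite -exprMn lerXn2r ?nnegrE// mulr_ge0// addr_ge0.
have u1 := expR_le_quadratic b2; have u2 := expR_ge1Dx b.
rewrite -[b ^+ 2]real_normK ?num_real// in u1.
rewrite controlledP_exp mxE -/r -/g -/b.
have -> : expR b * P x y - P x y - z * (g * P x y) =
    P x y * ((expR b - 1 - b) + r) by rewrite /b; ring.
rewrite normrM ger0_norm// -mulrA ler_pM//; first by lra.
rewrite (le_trans (ler_normD _ _))// mulrDl lerD//.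
by rewrite ger0_norm; lra.
Qed.

End ControlledKernel.

(** * Differentials from quadratic remainder bounds *)

(** A quadratic remainder is o(h), which determines the differential among continuous linear maps;
    the bound by [C1] provides the continuity of [L]. *)
Lemma is_diff_quadratic (R : realType) (V W : normedModType R) (f L : V -> W)
    (x : V) (C1 C : R) :
  linear L -> (forall h, `|L h| <= C1 * `|h|) ->
  (\forall h \near (0 : V), `|f (h + x) - f x - L h| <= C * `|h| ^+ 2) ->
  is_diff x f L.
Proof.
move=> linL L1 fC.
pose Ll : {linear V -> W} :=
  HB.pack L (GRing.isLinear.Build R V W *:%R L linL).
have Lc : continuous (Ll : V -> W).
  apply: bounded_linear_continuous; apply/bounded_funP => r.
  exists (`|C1| * r) => h hr; rewrite (le_trans (L1 h))//.
  rewrite (le_trans (ler_wpM2r (normr_ge0 _) (ler_norm C1)))//.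
  by rewrite ler_wpM2l.
have E : f \o shift x = cst (f x) + (Ll : V -> W) +o_ 0 id.
  apply/eqaddoP => e e0.
  have C0 : 0 < `|C| + 1 by rewrite ltr_wpDl.
  near=> h; have -> : (f \o shift x - (cst (f x) + (Ll : V -> W))) h =
      f (h + x) - f x - L h by rewrite !fctE /= opprD addrA.
  apply: (@le_trans _ _ (C * `|h| ^+ 2)); first by near: h.
  rewrite expr2 mulrA ler_wpM2r//.
  apply: (@le_trans _ _ ((`|C| + 1) * `|h|)).
    by rewrite ler_wpM2r// (le_trans (ler_norm C))// lerDl.
  rewrite mulrC -ler_pdivlMr//; near: h.
  exact: (nbhs0_le (divr_gt0 e0 C0)).
have dE : 'd f x = Ll :> (V -> W) by exact: diff_unique.
split; last by rewrite dE.
by apply/diff_locallyP; rewrite dE.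
Unshelve. all: by end_near. Qed.

Lemma mx_entry_le_norm (R : realType) (m n : nat) (A : 'M[R]_(m, n)) i j :
  `|A i j| <= `|A|.
Proof.
rewrite /Num.norm/= mx_normrE.
exact: (le_bigmax _ (fun ij : 'I_m * 'I_n => `|A ij.1 ij.2|) (i, j)).
Qed.

Lemma mx_norm_le (R : realType) (m n : nat) (A : 'M[R]_(m, n)) (c : R) :
  0 <= c -> (forall i j, `|A i j| <= c) -> `|A| <= c.
Proof.
move=> c0 h; rewrite /Num.norm/= mx_normrE.
by apply: bigmax_le => // ij _; exact: h.
Qed.

Lemma is_diff_state_map (R : realType) (d : nat) (p : 'rV[R]_d)
    (Pz : R -> 'M[R]_d) (E : 'M[R]_d) (C e : R) :
  0 <= C -> 0 < e ->
  (forall z x y, `|z| <= e ->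
    `|Pz z x y - Pz 0 x y - z * E x y| <= C * `|z| ^+ 2) ->
  is_diff (p, 0 : R^o) (state_map Pz)
    (fun h : 'rV[R]_d * R^o => h.1 *m Pz 0 + h.2 *: (p *m E)).
Proof.
move=> C0 e0 hP.
(* In each summand of [S], [|p 0 x|] serves the variation of the kernel and 1 the variation of the
   measure. *)
pose N : R := `|Pz 0| + `|E|; pose S : R := \sum_(x < d) (`|p 0 x| + 1).
have S0 : 0 <= S by apply: sumr_ge0 => x _; rewrite addr_ge0.
have h1 (h : 'rV[R]_d * R^o) x : `|h.1 0 x| <= `|h|.
  by rewrite (le_trans (mx_entry_le_norm _ _ _))// prod_normE le_max lexx.
have h2 (h : 'rV[R]_d * R^o) : `|h.2| <= `|h|.
  by rewrite prod_normE le_max lexx orbT.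
apply: (@is_diff_quadratic _ _ _ _ _ _ (S * N) (S * (`|E| + C))).
- move=> k u w /=; rewrite mulmxDl -scalemxAl scalerDl scalerDr scalerA.
  by rewrite addrACA.
- move=> h; apply: mx_norm_le => [|i j].
    by rewrite !mulr_ge0// addr_ge0.
  rewrite (ord1 i) !mxE mulr_sumr -big_split/=.
  rewrite (le_trans (ler_norm_sum _ _ _))// /S !mulr_suml.
  apply: ler_sum => x _; rewrite (le_trans (ler_normD _ _))// !normrM.
  have e1 := mx_entry_le_norm (Pz 0) x j.
  have e2 := mx_entry_le_norm E x j.
  have a1 := h1 h x; have a2 := h2 h.
  have n1 := normr_ge0 (Pz 0 x j); have n2 := normr_ge0 (E x j).
  have n3 := normr_ge0 (h.1 0 x); have n4 := normr_ge0 h.2.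
  have n5 := normr_ge0 (p 0 x).
  have b1 : `|h.1 0 x| * `|Pz 0 x j| <= `|h| * `|Pz 0| by exact: ler_pM.
  have b2 : `|h.2| * (`|p 0 x| * `|E x j|) <= `|h| * (`|p 0 x| * `|E|).
    by rewrite ler_pM ?mulr_ge0 ?ler_wpM2l.
  have b3 : 0 <= `|h| * (`|p 0 x| * `|Pz 0|) by rewrite !mulr_ge0.
  have b4 : 0 <= `|h| * `|E| by rewrite !mulr_ge0.
  by rewrite /N; lra.
near=> h; have hz : `|h.2| <= e.
  rewrite (le_trans (h2 h))//; near: h; exact: nbhs0_le.
have hz1 : `|h.2| <= 1.
  rewrite (le_trans (h2 h))//; near: h; exact: nbhs0_le.
apply: mx_norm_le => [|i j].
  by rewrite !mulr_ge0 ?sqr_ge0// addr_ge0.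
rewrite (ord1 i) /state_map /= addr0 !mxE mulr_sumr.
rewrite -sumrB -big_split/= -sumrB (le_trans (ler_norm_sum _ _ _))//.
rewrite /S !mulr_suml; apply: ler_sum => x _; rewrite !mxE.
set D := Pz h.2 x j - Pz 0 x j - h.2 * E x j.
(* The remainder is the measure increment times the whole kernel increment, plus [p] times the
   kernel's own remainder [D]. *)
have -> : (h.1 0 x + p 0 x) * Pz h.2 x j - p 0 x * Pz 0 x j -
    (h.1 0 x * Pz 0 x j + h.2 * (p 0 x * E x j)) =
    h.1 0 x * (D + h.2 * E x j) + p 0 x * D by rewrite /D; ring.
have hD : `|D| <= C * `|h| ^+ 2.
  rewrite (le_trans (hP _ _ _ hz))// ler_wpM2l// lerXn2r ?nnegrE//.
have hD1 : `|D| <= C * `|h|.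
  rewrite (le_trans (hP _ _ _ hz))// ler_wpM2l// (le_trans _ (h2 h))//.
  by rewrite expr2 ler_piMr.
have hDE : `|D + h.2 * E x j| <= (`|E| + C) * `|h|.
  rewrite (le_trans (ler_normD _ _))// addrC mulrDl lerD// normrM mulrC.
  by apply: ler_pM => //; exact: mx_entry_le_norm.
have n5 := normr_ge0 (p 0 x).
rewrite (le_trans (ler_normD _ _))// !normrM.
have b1 : `|h.1 0 x| * `|D + h.2 * E x j| <= `|h| * ((`|E| + C) * `|h|).
  exact: ler_pM.
have b2 : `|p 0 x| * `|D| <= `|p 0 x| * (C * `|h| ^+ 2) by exact: ler_wpM2l.
have b3 : 0 <= `|p 0 x| * (`|E| * `|h| ^+ 2) by rewrite !mulr_ge0 ?sqr_ge0.
by lra.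
Unshelve. all: by end_near. Qed.

Lemma is_derive_quadratic (R : realType) (d : nat) (Pz : R -> 'M[R]_d)
    (E : 'M[R]_d) (C e : R) :
  0 <= C -> 0 < e ->
  (forall z x y, `|z| <= e ->
    `|Pz z x y - Pz 0 x y - z * E x y| <= C * `|z| ^+ 2) ->
  is_derive (0 : R^o) (1 : R^o) (Pz : R^o -> 'M[R]_d) E.
Proof.
move=> C0 e0 hP.
have dP : is_diff (0 : R^o) (Pz : R^o -> 'M[R]_d) (fun z : R^o => z *: E).
  apply: (@is_diff_quadratic _ _ _ _ _ _ `|E| C).
  - by move=> k u w /=; rewrite scalerDl scalerA.
  - by move=> h; rewrite normrZ mulrC.
  near=> z; apply: mx_norm_le => [|i j].
    by rewrite mulr_ge0// sqr_ge0.
  rewrite !mxE addr0; apply: hP; near: z; exact: (nbhs0_le (V := R^o)).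
split; first exact: diff_derivable.
by rewrite deriveE// diff_val scale1r.
Unshelve. all: by end_near. Qed.

Lemma is_diff_mean (R : realType) (d : nat) (U : 'I_d -> R) (p : 'rV[R]_d) :
  is_diff p (mean U : 'rV[R]_d -> R^o) (mean U : 'rV[R]_d -> R^o).
Proof.
have linU : linear (mean U : 'rV[R]_d -> R^o).
  move=> k u w; rewrite /mean scaler_sumr -big_split/=.
  by apply: eq_bigr => x _; rewrite !mxE mulrDl -mulrA.
apply: (@is_diff_quadratic _ _ _ _ _ _ (\sum_x `|U x|) 0).
- exact: linU.
- move=> h; rewrite /mean (le_trans (ler_norm_sum _ _ _))// mulr_suml.
  apply: ler_sum => x _; rewrite normrM mulrC ler_wpM2l//.
  exact: mx_entry_le_norm.
near=> h; rewrite mul0r normr_le0.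
have := linU 1 h p; rewrite !scale1r => ->.
by rewrite addrK subrr.
Unshelve. all: by end_near.
Qed.

(** * Equilibrium, linearization and exponential form *)

Theorem mainTheorem4 (R : realType) (d : nat)
  (P0 : 'M[R]_d) (U : 'I_d -> R) (pi0 : 'rV[R]_d)
  (P0_stochastic : is_stochastic P0)
  (P0_irreducible : is_irreducible P0)
  (pi0_invariant : is_invariant_pmf P0 pi0)
  (lam : R -> R) (v : R -> 'cV[R]_d)
  (lam_perron : forall z, is_perron_eigenvalue (tiltedP U P0 z) (lam z))
  (v_gt0 : forall z x, 0 < v z x 0)
  (v_eigen : forall z, tiltedP U P0 z *m v z = lam z *: v z)
  (disp : measure_display) (Omega : measurableType disp)
  (Pr : 'I_d -> probability Omega R) (X : nat -> Omega -> 'I_d)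
  (X_markov : forall x, is_markov_chain (Pr x) P0 x X)
  (alpha : 'I_d) :
  let Pcheck := controlledP U P0 lam v in
  let F := state_map Pcheck in
  let G := mean U in
  let H := excursion_cost Pr X alpha (centered U pi0) in
  let E := calE P0 U pi0 H in
  let A := linA P0 in
  let B := linB P0 U pi0 H in
  let C := linC U in
  [/\ forall (m : 'rV[R]_d) (y : R),
        is_trajectory F G (fun=> 0) (fun=> m) (fun=> y) <->
        m = pi0 /\ y = \sum_x pi0 0 x * U x,
      is_diff (pi0, 0 : R^o) F
        (fun h : 'rV[R]_d * R^o => (A *m h.1^T + h.2 *: B)^T) /\
      is_diff pi0 (G : 'rV[R]_d -> R^o)
        (fun h : 'rV[R]_d => (C *m h^T) 0 0 : R^o),
      forall (zeta : nat -> R) (mu : nat -> 'rV[R]_d) (y : nat -> R),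
        is_trajectory F G zeta mu y ->
        forall (Phi : nat -> 'cV[R]_d) (gamma : nat -> R),
          is_linearization F G pi0 0 zeta (mu 0%N) Phi gamma <->
          [/\ forall i, Phi 0%N i 0 = mu 0%N 0 i - pi0 0 i,
              forall t, Phi t.+1 = A *m Phi t + zeta t *: B &
              forall t, gamma t = (C *m Phi t) 0 0],
      is_derive (0 : R^o) (1 : R^o) (Pcheck : R^o -> 'M[R]_d) E &
      forall xm xp : 'I_d,
        exists2 r : R^o -> R^o,
          r =O_ (0 : R^o) (fun z : R^o => z ^+ 2) &
          \forall z \near (0 : R),
            Pcheck z xm xp =
            expR (z * Gamma U pi0 H xm xp + r z) * P0 xm xp].
Proof.
move=> Pcheck F G H E A B C.
have lam_gt0 z : 0 < lam z by case: (lam_perron z).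
have HE x : H x = taboo_potential P0 alpha (centered U pi0) x.
  exact: (expectation_excursion alpha (X_markov x) P0_stochastic
    P0_irreducible pi0_invariant).
have poisson x : H x - \sum_y P0 x y * H y = centered U pi0 x.
  rewrite HE; under eq_bigr do rewrite HE.
  exact: (poisson_equation alpha).
have P00 : Pcheck 0 = P0 by exact: controlledP0.
have [K [e [K0 e0 hP]]] : exists K e : R, [/\ 0 <= K, 0 < e &
    forall z x y, `|z| <= e ->
    `|Pcheck z x y - Pcheck 0 x y - z * E x y| <= K * `|z| ^+ 2].
  by rewrite P00; exact: controlledP_expansion.
(* Transposition turns the column form with [A] and [B] into the row form of [is_diff_state_map]. *)
have FE : (fun h : 'rV[R]_d * R^o => (A *m h.1^T + h.2 *: B)^T) =
    (fun h => h.1 *m Pcheck 0 + h.2 *: (pi0 *m E)).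
  apply/funext => h; rewrite raddfD/= linearZ/= trmx_mul trmxK /A /linA trmxK P00.
  by congr (_ + _ *: _); apply/rowP => j; rewrite !mxE.
have GE : (fun h : 'rV[R]_d => (C *m h^T) 0 0 : R^o) = G.
  apply/funext => h; rewrite mxE; apply: eq_bigr => x _.
  by rewrite !mxE mulrC.
have dF : is_diff (pi0, 0 : R^o) F
    (fun h : 'rV[R]_d * R^o => (A *m h.1^T + h.2 *: B)^T).
  by rewrite FE; exact: is_diff_state_map hP.
have dG : is_diff pi0 (G : 'rV[R]_d -> R^o)
    (fun h : 'rV[R]_d => (C *m h^T) 0 0 : R^o).
  by rewrite GE; exact: is_diff_mean.
split.
- move=> m y; split => [tr|[-> ->] t].
    have [mpmf mF yG] := tr 0%N.
    have mE : m = pi0.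
      (* Since [Pcheck 0] is [P0], a constant trajectory is an invariant law. *)
      apply: (invariant_pmf_unique P0_stochastic P0_irreducible) => //.
      by split => //; rewrite [in RHS]mF /F /state_map/= P00.
    by split=> //; rewrite yG mE.
  by case: pi0_invariant => pp pP; split => //; rewrite /F /state_map/= P00 pP.
- by [].
- move=> zeta mu y _ Phi gamma; split.
    case=> _ _ Phi0 PhiS gam; split.
    + by move=> i; rewrite Phi0 !mxE.
    + move=> t; apply: trmx_inj; rewrite PhiS diff_val/= subr0 trmxK.
      by [].
    + by move=> t; rewrite gam diff_val/= trmxK.
  case=> Phi0 PhiS gam; split => //.
  + by apply/colP => i; rewrite Phi0 !mxE.
  + by move=> t; rewrite diff_val/= subr0 trmxK PhiS.
  + by move=> t; rewrite gam diff_val/= trmxK.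
- exact: is_derive_quadratic hP.
(* With this witness the exponential identity is exact for every [z]; only its order in [z] is
   asymptotic. *)
move=> xm xp; exists (log_remainder U H pi0 lam v xm xp).
  have [D [e1 [D0 e10 hr]]] := log_remainder_bound P0_stochastic
    P0_irreducible poisson v_gt0 v_eigen.
  apply/eqO_exP; exists (D + 1); first by rewrite ltr_wpDl.
  near=> z; have ze1 : `|z| <= e1 by near: z; exact: (nbhs0_le (V := R^o)).
  rewrite normrX real_normK ?num_real// (le_trans (hr z xm xp ze1))//.
  by rewrite ler_wpM2r ?sqr_ge0// lerDl.
by near=> z; exact: controlledP_exp.
Unshelve. all: by end_near. Qed.
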